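(* Let $X$ be an Archimedean real vector lattice such that $\langle X,X^{\sim}\rangle$ is a regular Riesz dual system. Then the following conditions are equivalent: (i) $X$ has $b$-property. (ii) For every net $(x_\alpha)$ in $X$: if $x_\alpha$ is $bbuo$-convergent to $0$, then $x_\alpha\xrightarrow{o}0$ in $X$. (iii) For every net $(x_\alpha)$ in $X$: if $\hat{x}_\alpha\xrightarrow{o}0$ in $X^{\sim\sim}$, then $x_\alpha\xrightarrow{o}0$ in $X$. (iv) For every net $(x_\alpha)$ in $X$: $\hat{x}_\alpha\xrightarrow{o}0$ in $X^{\sim\sim}$ if and only if $x_\alpha\xrightarrow{o}0$ in $X$.
   Context: All vector lattices are real and Archimedean. $X^{\sim}$ denotes the order dual of $X$ (the order bounded linear functionals on $X$) and $X^{\sim\sim}=(X^{\sim})^{\sim}$. For $x\in X$, $\hat{x}\in X^{\sim\sim}$ is given by $\hat{x}(y)=y(x)$ for $y\in X^{\sim}$, and $\hat{X}=\{\hat{x}:x\in X\}$. The pair $\langle X,X^{\sim}\rangle$ is a Riesz dual system if $X^{\sim}$ separates the points of $X$; in that case $x\mapsto\hat{x}$ is an injective lattice homomorphism and $\hat{X}$ is a vector sublattice of $X^{\sim\sim}$. It is a regular Riesz dual system if, in addition, $\hat{X}$ is a regular sublattice of $X^{\sim\sim}$. A sublattice $F$ of a vector lattice $E$ is regular if every net $z_\alpha\downarrow 0$ in $F$ (decreasing with infimum $0$ computed in $F$) also satisfies $z_\alpha\downarrow 0$ in $E$. Order convergence: $x_\alpha\xrightarrow{o}x$ in a vector lattice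 $E$ if there is a net $(y_\gamma)$ in $E$ (possibly with a different index set) with $y_\gamma\downarrow 0$ such that for every $\gamma$ there is $\alpha_\gamma$ with $|x_\alpha-x|\le y_\gamma$ for all $\alpha\ge\alpha_\gamma$. Unbounded order convergence: $x_\alpha\xrightarrow{uo}x$ in $E$ if $|x_\alpha-x|\wedge u\xrightarrow{o}0$ for every $u\in E_+$. A net $(x_\alpha)$ in $X$ is $bbuo$-convergent to $x\in X$ if $x_\alpha\xrightarrow{uo}x$ in $X$ and the net $(\hat{x}_\alpha)$ is eventually order bounded in $X^{\sim\sim}$ (i.e. some tail of it is contained in an order interval of $X^{\sim\sim}$). A subset $A\subseteq X$ is $b$-order bounded if $\hat{A}=\{\hat{a}:a\in A\}$ is order bounded in $X^{\sim\sim}$. $X$ has $b$-property if every $b$-order bounded subset of $X$ is order bounded in $X$. *)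

(* Defs.v *)
From HB Require Import structures.
From mathcomp Require Import all_boot all_order all_algebra.
From mathcomp Require Import boolp classical_sets reals.

Set Implicit Arguments.
Unset Strict Implicit.
Unset Printing Implicit Defensive.

Import Order.TTheory GRing.Theory Num.Theory.
Local Open Scope classical_set_scope.
Local Open Scope ring_scope.

(* The lattice operations are fields of the mixin rather than inherited from  *)
(* latticeType: a join of Order.Lattice and GRing.Lmodule cannot be declared  *)
(* on top of the existing numeric hierarchy.                                  *)
HB.mixin Record POrdered_isVectorLattice (R : numDomainType) E
    of Num.POrderedZmodule E & GRing.Lmodule R E := {
  vjoin : E -> E -> E;
  vmeet : E -> E -> E;
  vjoinP : forall x y z : E, (vjoin x y <= z) = (x <= z) && (y <= z);
  vmeetP : forall x y z : E, (x <= vmeet y z) = (x <= y) && (x <= z);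
  vl_leD2r : forall z x y : E, x <= y -> x + z <= y + z;
  vl_scale_ge0 : forall (a : R) (x : E), 0 <= a -> 0 <= x -> 0 <= a *: x }.

#[short(type="vectorLatticeType")]
HB.structure Definition VectorLattice (R : numDomainType) :=
  { E of Num.POrderedZmodule E & GRing.Lmodule R E &
         POrdered_isVectorLattice R E }.

Definition vpos (R : numDomainType) (E : vectorLatticeType R) (x : E) : E :=
  vjoin x 0.

Definition vabs (R : numDomainType) (E : vectorLatticeType R) (x : E) : E :=
  vjoin x (- x).

Section VectorLatticeTheory.
Context {R : realType} {E : vectorLatticeType R}.
Implicit Types x y z u v : E.

Lemma vjoinl x y : x <= vjoin x y.
Proof. by have := lexx (vjoin x y); rewrite vjoinP => /andP[]. Qed.

Lemma vjoinr x y : y <= vjoin x y.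
Proof. by have := lexx (vjoin x y); rewrite vjoinP => /andP[]. Qed.

Lemma vmeetl x y : vmeet x y <= x.
Proof. by have := lexx (vmeet x y); rewrite vmeetP => /andP[]. Qed.

Lemma vmeetr x y : vmeet x y <= y.
Proof. by have := lexx (vmeet x y); rewrite vmeetP => /andP[]. Qed.

Lemma vl_leBr0 x y : (0 <= y - x) = (x <= y).
Proof.
apply/idP/idP => [/(vl_leD2r x)|/(vl_leD2r (- x))]; first by rewrite add0r subrK.
by rewrite subrr.
Qed.

Lemma vl_leD2rE z x y : (x + z <= y + z) = (x <= y).
Proof. by rewrite -[LHS]vl_leBr0 opprD addrACA subrr addr0 vl_leBr0. Qed.

Lemma vl_leD x y u v : x <= y -> u <= v -> x + u <= y + v.
Proof.
move=> xy uv; apply: (@le_trans _ _ (y + u)); first by rewrite vl_leD2rE.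
by rewrite ![y + _]addrC vl_leD2rE.
Qed.

Lemma vl_addr_ge0 x y : 0 <= x -> 0 <= y -> 0 <= x + y.
Proof. by move=> x0 y0; rewrite -[0]addr0 vl_leD. Qed.

Lemma vl_leN2 x y : (- x <= - y) = (y <= x).
Proof. by rewrite -[LHS]vl_leBr0 opprK addrC vl_leBr0. Qed.

Lemma vl_leBlDr x y z : (x - y <= z) = (x <= z + y).
Proof. by rewrite -[LHS](vl_leD2rE y) subrK. Qed.

Lemma vl_leBrDr x y z : (x <= y - z) = (x + z <= y).
Proof. by rewrite -[LHS](vl_leD2rE z) subrK. Qed.

Lemma vl_scale_le (a : R) x y : 0 <= a -> x <= y -> a *: x <= a *: y.
Proof.
move=> a0 xy; rewrite -vl_leBr0 -scalerBr.
by apply: vl_scale_ge0 => //; rewrite vl_leBr0.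
Qed.

Lemma vpos_ge0 x : 0 <= vpos x. Proof. exact: vjoinr. Qed.

Lemma vpos_ge x : x <= vpos x. Proof. exact: vjoinl. Qed.

Lemma vpos_decomp x : x = vpos x - vpos (- x).
Proof.
suff E0 : vpos x = x + vpos (- x) by rewrite E0 addrK.
apply/eqP; rewrite eq_le; apply/andP; split.
  have xm : - x <= vpos (- x) by exact: vpos_ge.
  rewrite vjoinP [x + _]addrC -!vl_leBlDr subrr sub0r xm andbT.
  exact: vpos_ge0.
rewrite addrC -vl_leBrDr vjoinP !vl_leBrDr addNr add0r.
by rewrite vpos_ge0 vpos_ge.
Qed.

Lemma vpos_disj x w : w <= vpos x -> w <= vpos (- x) -> w <= 0.
Proof.
move=> wp wm; have xE : vpos (- x) = vpos x - x.
  by apply/eqP; rewrite eq_sym subr_eq addrC -subr_eq -vpos_decomp.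
have : vpos (- x) <= vpos (- x) - w.
  rewrite {1}/vpos vjoinP vl_leBr0 wm andbT xE.
  by rewrite -addrA -opprD [x + w]addrC opprD addrA vl_leBrDr addNr vl_leBr0.
by rewrite vl_leBrDr addrC -vl_leBrDr subrr.
Qed.

Lemma vjoin_vpos x y : vjoin x y = vpos (x - y) + y.
Proof.
apply/le_anti/andP; split.
  by rewrite vjoinP -!vl_leBlDr subrr vpos_ge vpos_ge0.
by rewrite -vl_leBrDr /vpos vjoinP !vl_leBrDr subrK add0r vjoinl vjoinr.
Qed.

Lemma vmeetE x y : vmeet x y = - vjoin (- x) (- y).
Proof.
apply/le_anti/andP; split.
  by rewrite -vl_leN2 opprK vjoinP !vl_leN2 vmeetl vmeetr.
by rewrite vmeetP -[_ <= x]vl_leN2 -[_ <= y]vl_leN2 opprK vjoinl vjoinr.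
Qed.

Lemma riesz_decomp x y z : 0 <= x -> 0 <= y -> 0 <= z -> z <= x + y ->
  exists u v, [/\ 0 <= u, u <= x, 0 <= v, v <= y & z = u + v].
Proof.
move=> x0 y0 z0 zxy; exists (vmeet z x), (z - vmeet z x); split.
- by rewrite vmeetP z0.
- exact: vmeetr.
- by rewrite vl_leBr0 vmeetl.
- have: z - y <= vmeet z x.
    by rewrite vmeetP !vl_leBlDr zxy andbT -{1}[z]addr0 vl_leD.
  by rewrite !vl_leBlDr addrC.
- by rewrite addrC subrK.
Qed.

End VectorLatticeTheory.

Definition order_bounded_functional (R : realType) (X : vectorLatticeType R)
    (f : X -> R) : Prop :=
  forall a b : X, exists M : R, forall x, a <= x <= b -> `|f x| <= M.

Record odual (R : realType) (X : vectorLatticeType R) := Odual {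
  odual_fun :> X -> R;
  odual_scalar : scalar odual_fun;
  odual_bounded : order_bounded_functional odual_fun }.

HB.instance Definition _ (R : realType) (X : vectorLatticeType R) :=
  gen_eqMixin (odual X).
HB.instance Definition _ (R : realType) (X : vectorLatticeType R) :=
  gen_choiceMixin (odual X).

Section OrderDual.
Context {R : realType} {X : vectorLatticeType R}.
Implicit Types (f g h : odual X) (x y z : X).

Lemma odual_ext f g : f =1 g -> f = g.
Proof.
case: f g => [f fl fb] [g gl gb] /= /funext fg; subst g.
by congr Odual; exact: Prop_irrelevance.
Qed.

Lemma odualD f x y : f (x + y) = f x + f y.
Proof. by have := odual_scalar f 1 x y; rewrite scale1r mul1r. Qed.

Lemma odual0 f : f 0 = 0.
Proof. by apply: (@addrI _ (f 0)); rewrite -odualD !addr0. Qed.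

Lemma odualZ f a x : f (a *: x) = a * f x.
Proof. by have := odual_scalar f a x 0; rewrite odual0 !addr0. Qed.

Lemma odualN f x : f (- x) = - f x.
Proof. by rewrite -scaleN1r odualZ mulN1r. Qed.

Lemma odualB f x y : f (x - y) = f x - f y.
Proof. by rewrite odualD odualN. Qed.

Fact odual0_scalar : scalar (fun _ : X => 0 : R).
Proof. by move=> a x y /=; rewrite mulr0 addr0. Qed.
Fact odual0_bounded : order_bounded_functional (fun _ : X => 0 : R).
Proof. by move=> a b; exists 0 => x _; rewrite normr0. Qed.
Definition odual_zero := Odual odual0_scalar odual0_bounded.

Fact odualN_scalar f : scalar (fun x => - f x).
Proof. by move=> a x y /=; rewrite odual_scalar opprD mulrN. Qed.
Fact odualN_bounded f : order_bounded_functional (fun x => - f x).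
Proof.
move=> a b; have [M fM] := odual_bounded f a b.
by exists M => x /fM; rewrite normrN.
Qed.
Definition odual_opp f := Odual (odualN_scalar f) (odualN_bounded f).

Fact odualD_scalar f g : scalar (fun x => f x + g x).
Proof. by move=> a x y /=; rewrite !odual_scalar mulrDr addrACA. Qed.
Fact odualD_bounded f g : order_bounded_functional (fun x => f x + g x).
Proof.
move=> a b; have [M fM] := odual_bounded f a b.
have [N gN] := odual_bounded g a b.
exists (M + N) => x xab; apply: le_trans (ler_normD _ _) _.
by rewrite lerD ?fM ?gN.
Qed.
Definition odual_add f g := Odual (odualD_scalar f g) (odualD_bounded f g).

Fact odualZ_scalar (c : R) f : scalar (fun x => c * f x).
Proof. by move=> a x y /=; rewrite odual_scalar mulrDr mulrCA. Qed.
Fact odualZ_bounded (c : R) f : order_bounded_functional (fun x => c * f x).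
Proof.
move=> a b; have [M fM] := odual_bounded f a b.
by exists (`|c| * M) => x xab; rewrite normrM ler_wpM2l ?fM.
Qed.
Definition odual_scale c f := Odual (odualZ_scalar c f) (odualZ_bounded c f).

Fact odual_addA : associative odual_add.
Proof. by move=> f g h; apply: odual_ext => x /=; rewrite addrA. Qed.
Fact odual_addC : commutative odual_add.
Proof. by move=> f g; apply: odual_ext => x /=; rewrite addrC. Qed.
Fact odual_add0 : left_id odual_zero odual_add.
Proof. by move=> f; apply: odual_ext => x /=; rewrite add0r. Qed.
Fact odual_addN : left_inverse odual_zero odual_opp odual_add.
Proof. by move=> f; apply: odual_ext => x /=; rewrite addNr. Qed.

HB.instance Definition _ := GRing.isZmodule.Build (odual X)
  odual_addA odual_addC odual_add0 odual_addN.

Fact odual_scaleA a b f :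
  odual_scale a (odual_scale b f) = odual_scale (a * b) f.
Proof. by apply: odual_ext => x /=; rewrite mulrA. Qed.
Fact odual_scale1 : left_id 1 odual_scale.
Proof. by move=> f; apply: odual_ext => x /=; rewrite mul1r. Qed.
Fact odual_scaleDr : right_distributive odual_scale +%R.
Proof. by move=> a f g; apply: odual_ext => x /=; rewrite mulrDr. Qed.
Fact odual_scaleDl f : {morph odual_scale^~ f : a b / a + b}.
Proof. by move=> a b; apply: odual_ext => x /=; rewrite mulrDl. Qed.

HB.instance Definition _ := GRing.Zmodule_isLmodule.Build R (odual X)
  odual_scaleA odual_scale1 odual_scaleDr odual_scaleDl.

Definition odual_le f g : bool := `[< forall x : X, 0 <= x -> f x <= g x >].

Fact odual_lexx : reflexive odual_le.
Proof. by move=> f; apply/asboolP. Qed.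
Fact odual_le_anti : antisymmetric odual_le.
Proof.
move=> f g /andP[/asboolP fg /asboolP gf]; apply: odual_ext => x.
have fgE y : 0 <= y -> f y = g y.
  by move=> y0; apply/eqP; rewrite eq_le fg ?gf.
by rewrite (vpos_decomp x) !odualB !fgE ?vpos_ge0.
Qed.
Fact odual_le_trans : transitive odual_le.
Proof.
move=> g f h /asboolP fg /asboolP gh; apply/asboolP => x x0.
exact: le_trans (fg _ x0) (gh _ x0).
Qed.

HB.instance Definition _ := Order.Le_isPOrder.Build ring_display (odual X)
  odual_lexx odual_le_anti odual_le_trans.

Lemma odual_leP f g : reflect (forall x, 0 <= x -> f x <= g x) (f <= g).
Proof. exact: asboolP. Qed.

Fact odual_leD2r (h f g : odual X) : f <= g -> f + h <= g + h.
Proof. by move=> /odual_leP fg; apply/odual_leP => x x0 /=; rewrite lerD2r fg. Qed.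

Fact odual_scale_ge0 (a : R) f : 0 <= a -> 0 <= f -> 0 <= a *: f.
Proof.
by move=> a0 /odual_leP f0; apply/odual_leP => x x0 /=; rewrite mulr_ge0 ?f0.
Qed.

(* The Riesz-Kantorovich construction relative to an ideal K: on the positive *)
(* cone, x |-> sup {f y | 0 <= y <= x, K y}. For K = X this is the positive   *)
(* part of f.                                                                 *)
Section RieszKantorovich.
Variables (K : X -> Prop) (f : odual X).
Hypotheses (K0 : K 0) (KD : forall x y, K x -> K y -> K (x + y))
  (KZ : forall (a : R) x, 0 <= a -> K x -> K (a *: x))
  (Kle : forall x y, 0 <= x -> x <= y -> K y -> K x).

Let S x : set R := fun r => exists y, [/\ 0 <= y, y <= x, K y & r = f y].
Let p x := sup (S x).

Let S_ub x : exists M : R, forall r, S x r -> r <= M.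
Proof.
have [M fM] := odual_bounded f 0 x; exists M => _ [y [y0 yx _ ->]].
by apply: le_trans (ler_norm _) _; rewrite fM ?y0.
Qed.

Let p_ge x y : 0 <= y -> y <= x -> K y -> f y <= p x.
Proof.
move=> y0 yx Ky; apply: ub_le_sup; last by exists y.
by have [M SM] := S_ub x; exists M => r /SM.
Qed.

Let p_le x M : 0 <= x -> (forall y, 0 <= y -> y <= x -> K y -> f y <= M) ->
  p x <= M.
Proof.
move=> x0 fM; apply: ge_sup; first by exists (f 0), 0; split.
by move=> _ [y [y0 yx Ky ->]]; exact: fM.
Qed.

Let p_ge0 x : 0 <= x -> 0 <= p x.
Proof. by move=> x0; rewrite -(odual0 f) p_ge. Qed.

Let pD x y : 0 <= x -> 0 <= y -> p (x + y) = p x + p y.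
Proof.
move=> x0 y0; apply/eqP; rewrite eq_le; apply/andP; split.
  apply: p_le => [|z z0 zxy Kz]; first exact: vl_addr_ge0.
  have [u [v [u0 ux v0 vy zuv]]] := riesz_decomp x0 y0 z0 zxy.
  have Ku : K u.
    by apply: Kle Kz => //; rewrite zuv -[leLHS]addr0 vl_leD.
  have Kv : K v.
    by apply: Kle Kz => //; rewrite zuv -[leLHS]add0r vl_leD.
  by rewrite zuv odualD lerD ?p_ge.
rewrite -lerBrDr; apply: p_le => // u u0 ux Ku.
rewrite lerBrDr -lerBrDl; apply: p_le => // v v0 vy Kv.
by rewrite lerBrDl -odualD p_ge ?vl_addr_ge0 ?vl_leD //; exact: KD.
Qed.

Let pZ_le (a : R) x : 0 < a -> 0 <= x -> a * p x <= p (a *: x).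
Proof.
move=> a0 x0; rewrite -ler_pdivlMl //; apply: p_le => // y y0 yx Ky.
rewrite ler_pdivlMl // -odualZ p_ge ?vl_scale_ge0 ?vl_scale_le ?(ltW a0) //.
by apply: KZ => //; exact: ltW.
Qed.

Let pZ (a : R) x : 0 <= a -> 0 <= x -> p (a *: x) = a * p x.
Proof.
rewrite le0r => /orP[/eqP-> x0|a0 x0].
  rewrite scale0r mul0r; apply: (@addrI _ (p 0)).
  by rewrite addr0 -pD ?addr0.
apply/eqP; rewrite eq_le pZ_le // andbT -ler_pdivrMl //.
have ax0 : 0 <= a *: x by apply: vl_scale_ge0 => //; exact: ltW.
have ai0 : 0 < a^-1 by rewrite invr_gt0.
by have := pZ_le ai0 ax0; rewrite scalerA mulVf ?scale1r // gt_eqF.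
Qed.

Definition rk_fun x : R := p (vpos x) - p (vpos (- x)).

Let rk_funE u v : 0 <= u -> 0 <= v -> rk_fun (u - v) = p u - p v.
Proof.
move=> u0 v0; rewrite /rk_fun; set a := vpos _; set b := vpos _.
have a0 : 0 <= a by exact: vpos_ge0.
have b0 : 0 <= b by exact: vpos_ge0.
have abE : a + v = u + b.
  by apply/eqP; rewrite -subr_eq addrAC -vpos_decomp subrK.
have pE : p a + p v = p u + p b by rewrite -!pD // abE.
by apply/eqP; rewrite subr_eq addrAC eq_sym subr_eq pE.
Qed.

Lemma rk_scalar : scalar rk_fun.
Proof.
have rkD x y : rk_fun (x + y) = rk_fun x + rk_fun y.
  rewrite {1}(vpos_decomp x) {1}(vpos_decomp y) addrACA -opprD.
  by rewrite rk_funE ?vl_addr_ge0 ?vpos_ge0 // !pD ?vpos_ge0 // opprD addrACA.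
have rkZ a x : 0 <= a -> rk_fun (a *: x) = a * rk_fun x.
  move=> a0; rewrite {1}(vpos_decomp x) scalerBr.
  by rewrite rk_funE ?vl_scale_ge0 ?vpos_ge0 // !pZ ?vpos_ge0 // mulrBr.
have rkN x : rk_fun (- x) = - rk_fun x by rewrite /rk_fun opprK opprB.
move=> a x y /=; rewrite rkD; congr (_ + _).
have [a0|a0] := leP 0 a; first exact: rkZ.
by rewrite -[a]opprK scaleNr rkN rkZ ?mulNr // oppr_ge0 ltW.
Qed.

Let rk_pos x : 0 <= x -> rk_fun x = p x.
Proof.
move=> x0; rewrite -{1}[x]subr0 rk_funE //.
have /eqP : p (0 + 0) = p 0 + p 0 by rewrite pD.
by rewrite addr0 -subr_eq subrr => /eqP <-; rewrite subr0.
Qed.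

Lemma rk_bounded : order_bounded_functional rk_fun.
Proof.
have rkle x y : x <= y -> rk_fun x <= rk_fun y.
  move=> xy; have xy0 : 0 <= y - x by rewrite vl_leBr0.
  have := rk_scalar 1 (y - x) x; rewrite scale1r subrK mul1r => ->.
  by rewrite lerDr rk_pos ?p_ge0.
move=> a b; exists (`|rk_fun a| + `|rk_fun b|) => x /andP[/rkle ax /rkle xb].
rewrite ler_norml; apply/andP; split.
  apply: le_trans ax; rewrite lerNl; apply: le_trans (ler_norm _) _.
  by rewrite normrN lerDl.
by apply: le_trans xb _; apply: le_trans (ler_norm _) _; rewrite lerDr.
Qed.

Definition rk := Odual rk_scalar rk_bounded.

Lemma rk_ge x y : 0 <= y -> y <= x -> K y -> f y <= rk x.
Proof.
by move=> y0 yx Ky; rewrite /= rk_pos ?p_ge //; exact: le_trans yx.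
Qed.

Lemma rk_le x M : 0 <= x -> (forall y, 0 <= y -> y <= x -> K y -> f y <= M) ->
  rk x <= M.
Proof. by move=> x0 fM; rewrite /= rk_pos // p_le. Qed.

End RieszKantorovich.

Definition odual_pos f : odual X :=
  rk (K := fun=> True) f I (fun _ _ _ _ => I) (fun _ _ _ _ => I)
     (fun _ _ _ _ _ => I).

Lemma odual_posP f h : (odual_pos f <= h) = (f <= h) && (0 <= h).
Proof.
apply/idP/andP => [fh|[/odual_leP fh /odual_leP h0]].
  split; apply: le_trans fh; apply/odual_leP => x x0; first exact: rk_ge.
  by rewrite -[leLHS]/(0 : R) -(odual0 f) rk_ge.
apply/odual_leP => x x0; apply: rk_le => // y y0 yx _.
apply: le_trans (fh _ y0) _; rewrite -subr_ge0 -odualB; apply: h0.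
by rewrite vl_leBr0.
Qed.

Definition odual_join f g : odual X := odual_pos (f - g) + g.
Definition odual_meet f g : odual X := - odual_join (- f) (- g).

Let odual_leBr0 f g : (0 <= g - f) = (f <= g).
Proof.
apply/idP/idP => [/(odual_leD2r f)|/(odual_leD2r (- f))].
  by rewrite add0r subrK.
by rewrite subrr.
Qed.

Let odual_leBrDr f g h : (f <= g - h) = (f + h <= g).
Proof. by rewrite -odual_leBr0 -[in RHS]odual_leBr0 opprD addrA addrAC. Qed.

Fact odual_joinP f g h : (odual_join f g <= h) = (f <= h) && (g <= h).
Proof.
by rewrite /odual_join -odual_leBrDr odual_posP odual_leBrDr subrK odual_leBr0.
Qed.

Fact odual_meetP f g h : (f <= odual_meet g h) = (f <= g) && (f <= h).
Proof.
have leN u v : (u <= - v :> odual X) = (v <= - u).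
  by rewrite -odual_leBr0 -[RHS]odual_leBr0 addrC.
by rewrite /odual_meet leN odual_joinP 2!leN !opprK.
Qed.

HB.instance Definition _ :=
  POrdered_isVectorLattice.Build R (odual X)
    odual_joinP odual_meetP odual_leD2r odual_scale_ge0.

End OrderDual.

Section Evaluation.
Context {R : realType} {X : vectorLatticeType R}.
Implicit Types (x y : X) (f g h : odual X).

Fact hat_scalar x : scalar (fun f : odual X => f x).
Proof. by []. Qed.

Fact hat_bounded x : order_bounded_functional (fun f : odual X => f x).
Proof.
move=> g h; set p := vpos x; set m := vpos (- x).
exists (`|h p - g m| + `|g p - h m|) => f /andP[/odual_leP gf /odual_leP fh].
have [p0 m0] : 0 <= p /\ 0 <= m by split; exact: vpos_ge0.
rewrite {1}(vpos_decomp x) odualB ler_norml; apply/andP; split.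
  apply: (@le_trans _ _ (g p - h m)); last by rewrite lerB ?gf ?fh.
  rewrite lerNl; apply: le_trans (ler_norm _) _.
  by rewrite normrN lerDr.
apply: (@le_trans _ _ (h p - g m)); first by rewrite lerB ?gf ?fh.
by apply: le_trans (ler_norm _) _; rewrite lerDl.
Qed.

Definition hat x : odual (odual X) := Odual (hat_scalar x) (hat_bounded x).

Lemma hat_linear : linear hat.
Proof. by move=> a x y; apply: odual_ext => f; exact: odual_scalar. Qed.

Lemma hat_le x y : x <= y -> hat x <= hat y.
Proof.
rewrite -vl_leBr0 => xy; apply/odual_leP => f /odual_leP/(_ _ xy) f0.
by rewrite /= -subr_ge0 -odualB.
Qed.

(* f splits off a part 0 <= g <= f carried by the ideal of vpos x, so that    *)
(* g x = f (vpos x).                                                          *)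
Lemma odual_carried f x : 0 <= f ->
  exists g, [/\ 0 <= g, g <= f & g x = f (vpos x)].
Proof.
move=> /odual_leP f0; pose K y := exists n : nat, y <= vpos x *+ n.
have vMn n : 0 <= vpos x *+ n :> X.
  elim: n => [|n IH]; rewrite ?mulr0n// mulrS.
  exact: vl_addr_ge0 (vpos_ge0 x) IH.
have K0 : K 0 by exists 0%N.
have KD y z : K y -> K z -> K (y + z).
  by move=> [n yn] [m zm]; exists (n + m)%N; rewrite mulrnDr vl_leD.
have KZ (a : R) y : 0 <= a -> K y -> K (a *: y).
  move=> a0 [n yn]; pose k := (Num.truncn a).+1; exists (n * k)%N.
  have ak : a <= k%:R by apply/ltW; exact: truncnS_gt.
  apply: le_trans (vl_scale_le a0 yn) _.
  rewrite -vl_leBr0 mulrnA -[X in X - _]scaler_nat -scalerBl.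
  by apply: vl_scale_ge0 => //; rewrite subr_ge0.
have Kle y z : 0 <= y -> y <= z -> K z -> K y.
  by move=> _ yz [n zn]; exists n; exact: le_trans zn.
have f0le y z : y <= z -> f y <= f z.
  by rewrite -vl_leBr0 => yz; rewrite -subr_ge0 -odualB; exact: f0.
exists (rk f K0 KD KZ Kle); split.
- apply/odual_leP => y y0; rewrite -[leLHS]/(0 : R) -(odual0 f).
  exact: rk_ge.
- by apply/odual_leP => y y0; apply: rk_le => // z _ zy _; exact: f0le.
rewrite {1}(vpos_decomp x) odualB.
have -> : rk f K0 KD KZ Kle (vpos x) = f (vpos x).
  apply/eqP; rewrite eq_le; apply/andP; split.
    by apply: rk_le; rewrite ?vpos_ge0 // => z _ zx _; exact: f0le.
  by apply: rk_ge; rewrite ?vpos_ge0 //; exists 1%N.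
suff -> : rk f K0 KD KZ Kle (vpos (- x)) = 0 by rewrite subr0.
apply/eqP; rewrite eq_le; apply/andP; split; last first.
  by rewrite -[leLHS](odual0 f); apply: rk_ge; rewrite ?vpos_ge0.
apply: rk_le; rewrite ?vpos_ge0 // => y y0 yx [n yn].
rewrite -(odual0 f); apply: f0le; pose c : R := n.+1%:R^-1.
have c0 : 0 <= c by rewrite invr_ge0 ler0n.
have cK (z : X) : n.+1%:R *: (c *: z) = z.
  by rewrite scalerA mulfV ?scale1r // pnatr_eq0.
suff : c *: y <= 0.
  by move=> /(vl_scale_le (ler0n R n.+1)); rewrite cK scaler0.
apply: (@vpos_disj R X x).
  rewrite -[leRHS](scale1r) -[1](mulVf (_ : n.+1%:R != 0 :> R)) ?pnatr_eq0 //.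
  rewrite -scalerA; apply: vl_scale_le => //; apply: le_trans yn _.
  by rewrite scaler_nat mulrSr -{1}[_ *+ n]addr0 vl_leD // vpos_ge0.
apply: le_trans yx; rewrite -{2}[y](cK y) -[leLHS]scale1r.
rewrite -vl_leBr0 -scalerBl vl_scale_ge0 ?vl_scale_ge0 //.
by rewrite subr_ge0 ler1n.
Qed.

Lemma hat_vpos x : hat (vpos x) = vjoin (hat x) 0.
Proof.
apply/eqP; rewrite eq_le vjoinP; apply/andP; split; last first.
  rewrite hat_le ?vpos_ge //; have -> : 0 = hat 0.
    by apply: odual_ext => f /=; rewrite odual0.
  by rewrite hat_le ?vpos_ge0.
apply/odual_leP => f f0; have [g [g0 gf gx]] := odual_carried x f0.
have /odual_leP/(_ g g0) xg := vjoinl (hat x) 0.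
have /odual_leP/(_ (f - g)) := vjoinr (hat x) 0.
rewrite !odualB vl_leBr0 => /(_ gf).
rewrite -[leLHS]/(0 - 0 : R) subrr subr_ge0; apply: le_trans.
by rewrite -[leLHS]/(f (vpos x)) -gx.
Qed.

Lemma hat0 : hat 0 = 0.
Proof. by apply: odual_ext => f; exact: odual0. Qed.

Lemma hatD x y : hat (x + y) = hat x + hat y.
Proof. by apply: odual_ext => f; exact: odualD. Qed.

Lemma hatN x : hat (- x) = - hat x.
Proof. by apply: odual_ext => f; exact: odualN. Qed.

Lemma hat_vjoin x y : hat (vjoin x y) = vjoin (hat x) (hat y).
Proof. by rewrite !vjoin_vpos hatD hat_vpos hatD hatN. Qed.

Lemma hat_vmeet x y : hat (vmeet x y) = vmeet (hat x) (hat y).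
Proof. by rewrite !vmeetE hatN hat_vjoin !hatN. Qed.

End Evaluation.

(* A preorder; antisymmetry is not required of the index sets of nets.        *)
Record directedSet := DirectedSet {
  ds_sort :> Type;
  ds_le : ds_sort -> ds_sort -> Prop;
  ds_refl : forall i, ds_le i i;
  ds_trans : forall i j k, ds_le i j -> ds_le j k -> ds_le i k;
  ds_upper : forall i j, exists k, ds_le i k /\ ds_le j k;
  ds_inhabited : inhabited ds_sort }.

Section VectorLatticeNotions.
Context {R : realType} {E : vectorLatticeType R}.

Definition archimedean : Prop :=
  forall x y : E, (forall n : nat, x *+ n.+1 <= y) -> x <= 0.

Definition order_bounded (A : set E) : Prop :=
  exists a b : E, forall x, A x -> a <= x <= b.

Definition vector_sublattice (F : set E) : Prop :=
  [/\ F 0,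
     forall (a : R) x y, F x -> F y -> F (a *: x + y),
     forall x y, F x -> F y -> F (vjoin x y) &
     forall x y, F x -> F y -> F (vmeet x y)].

(* z is a net in F that decreases to 0, the infimum being computed in F.      *)
Definition decreases_to0_in (F : set E) (J : directedSet) (z : J -> E) : Prop :=
  [/\ forall j, F (z j),
     forall i j, ds_le i j -> z j <= z i,
     forall j, 0 <= z j &
     forall w, F w -> (forall j, w <= z j) -> w <= 0].

Definition decreases_to0 (J : directedSet) (z : J -> E) : Prop :=
  decreases_to0_in setT z.

Definition regular_sublattice (F : set E) : Prop :=
  vector_sublattice F /\
  forall (J : directedSet) (z : J -> E),
    decreases_to0_in F z -> decreases_to0 z.

Definition order_cvg (I : directedSet) (x : I -> E) (l : E) : Prop :=
  exists (J : directedSet) (y : J -> E), decreases_to0 y /\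
    forall j, exists i0, forall i, ds_le i0 i -> vabs (x i - l) <= y j.

Definition uo_cvg (I : directedSet) (x : I -> E) (l : E) : Prop :=
  forall u, 0 <= u -> order_cvg (fun i => vmeet (vabs (x i - l)) u) 0.

Definition eventually_order_bounded (I : directedSet) (x : I -> E) : Prop :=
  exists i0, order_bounded [set x i | i in [set i | ds_le i0 i]].

End VectorLatticeNotions.

Arguments archimedean {R} E.

Section DualSystem.
Context {R : realType} (X : vectorLatticeType R).

Definition odual_separates_points : Prop :=
  forall x y : X, x <> y -> exists f : odual X, f x <> f y.

Definition regular_riesz_dual_system : Prop :=
  odual_separates_points /\ regular_sublattice (range (@hat R X)).

(* The sublattice clause of regular_sublattice holds for every X.             *)
Lemma hat_sublattice : vector_sublattice (range (@hat R X)).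
Proof.
split; first by exists 0; rewrite ?hat0.
- by move=> a _ _ [x _ <-] [y _ <-]; exists (a *: x + y); rewrite ?hat_linear.
- by move=> _ _ [x _ <-] [y _ <-]; exists (vjoin x y); rewrite ?hat_vjoin.
- by move=> _ _ [x _ <-] [y _ <-]; exists (vmeet x y); rewrite ?hat_vmeet.
Qed.

Definition b_order_bounded (A : set X) : Prop :=
  order_bounded [set hat x | x in A].

Definition b_property : Prop :=
  forall A : set X, b_order_bounded A -> order_bounded A.

Definition bbuo_cvg (I : directedSet) (x : I -> X) (l : X) : Prop :=
  uo_cvg x l /\ eventually_order_bounded (fun i => hat (x i)).

End DualSystem.

(* Main.v *)
Require Import Defs.
From mathcomp Require Import all_boot all_order all_algebra.
From mathcomp Require Import boolp classical_sets reals.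

(** In an Archimedean vector lattice, a nonempty join-closed set T bounded above
    satisfies U - T \downarrow 0, where U is the set of its upper bounds. This
    gap net replaces the supremum of T, so that no Dedekind completion of X is
    needed, nor the Dedekind completeness of X~~.

    For (ii) => (iii), suppose |x_i| is eventually below each y_j \downarrow 0
    in X~~ and fix u >= 0. The gap net of T_j = {t <= u | t^ <= y_j} decreases
    to 0 in X, hence in X~~ by regularity; so any w below all upper bounds of
    all the T_j satisfies w^ <= y_j for every j. Thus these upper bounds
    decrease to 0 and eventually dominate |x_i| /\ u.

    For (iv) => (i), if T = {t | t^ <= b}, the gap net of T^ shows that
    s^ - t^ (s, t in T) converges to 0 in order in X~~. Hence s - t does in X,
    and an eventual bound of s - t, for s above a fixed t, bounds T. *)

Import Order.TTheory GRing.Theory Num.Theory.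
Local Open Scope classical_set_scope.
Local Open Scope ring_scope.

(** * Absolute values, and decreasing nets indexed by sets of bounds *)

Section VectorLatticeComplements.
Context {R : realType} {E : vectorLatticeType R}.
Implicit Types (x y z u w : E) (T : set E).

Lemma vabsP x z : (vabs x <= z) = (x <= z) && (- x <= z).
Proof. exact: vjoinP. Qed.

Lemma vabs_ge x : x <= vabs x. Proof. exact: vjoinl. Qed.

Lemma vabs_geN x : - x <= vabs x. Proof. exact: vjoinr. Qed.

Lemma vabs_ge0 x : 0 <= vabs x.
Proof.
have h : 0 <= vabs x + vabs x.
  by rewrite -(subrr x); apply: vl_leD; [exact: vabs_ge | exact: vabs_geN].
have h2 : 0 <= (2^-1 : R) *: (vabs x + vabs x).
  by apply: vl_scale_ge0; rewrite ?invr_ge0 ?ler0n.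
by move: h2; rewrite -mulr2n -scaler_nat scalerA mulVf ?scale1r // pnatr_eq0.
Qed.

Lemma ge0_vabs x : 0 <= x -> vabs x = x.
Proof.
move=> x0; apply/le_anti/andP; split; last exact: vabs_ge.
by rewrite vabsP lexx /=; apply: (le_trans _ x0); rewrite -oppr0 vl_leN2.
Qed.

Lemma vmeet_idl x u : x <= u -> vmeet x u = x.
Proof.
by move=> xu; apply/le_anti/andP; split; rewrite ?vmeetl // vmeetP lexx.
Qed.

Lemma vmeet_ge0 x u : 0 <= x -> 0 <= u -> 0 <= vmeet x u.
Proof. by move=> x0 u0; rewrite vmeetP x0. Qed.

Lemma order_cvg_eventually_bounded (I : directedSet) (x : I -> E) :
  order_cvg x 0 -> eventually_order_bounded x.
Proof.
move=> [J [y [_ xy]]]; case: (ds_inhabited J) => j.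
have [i0 xi0] := xy j; exists i0, (- y j), (y j) => _ [i ii0 <-].
have := xi0 i ii0; rewrite subr0 vabsP => /andP[xi Nxi].
by rewrite -vl_leN2 opprK Nxi.
Qed.

(** The order is reversed so that [sval] is a decreasing net. *)
Definition upper_set_index (D : set E) (D0 : D !=set0)
  (Dmeet : forall x y, D x -> D y -> D (vmeet x y)) : directedSet.
Proof.
refine (@DirectedSet {z | D z} (fun i j => sval j <= sval i) _ _ _ _).
- by move=> z.
- by move=> i j k ji kj; exact: (le_trans kj ji).
- move=> [z Dz] [z' Dz']; exists (exist _ _ (Dmeet _ _ Dz Dz')) => /=.
  by split; [exact: vmeetl | exact: vmeetr].
- by case: D0 => z Dz; constructor; exists z.
Defined.

Definition gap_index T (T0 : T !=set0) (Tub : ubound T !=set0)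
  (Tjoin : forall x y, T x -> T y -> T (vjoin x y)) : directedSet.
Proof.
refine (@DirectedSet {zt : E * E | ubound T zt.1 /\ T zt.2}
  (fun i j => (sval j).1 <= (sval i).1 /\ (sval i).2 <= (sval j).2) _ _ _ _).
- by move=> i.
- move=> i j k [ji1 ij2] [kj1 jk2].
  by split; [exact: le_trans kj1 ji1 | exact: le_trans ij2 jk2].
- move=> [[z t] /= [Uz Tt]] [[z' t'] /= [Uz' Tt']].
  have Uk : ubound T (vmeet z z').
    by move=> s Ts; rewrite vmeetP Uz ?Uz'.
  exists (exist _ (vmeet z z', vjoin t t') (conj Uk (Tjoin _ _ Tt Tt'))) => /=.
  by rewrite vmeetl vmeetr vjoinl vjoinr.
- by case: T0 Tub => t Tt [z Uz]; constructor; exists (z, t).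
Defined.

(** If w lies below every gap, subtracting w from an upper bound of T gives another upper bound.
    Iterating, every multiple of w lies below one fixed gap, and the Archimedean property gives w <=
    0. *)
Lemma gap_decreases_to0 T (T0 : T !=set0) (Tub : ubound T !=set0)
    (Tjoin : forall x y, T x -> T y -> T (vjoin x y)) :
  archimedean E ->
  decreases_to0 (fun i : gap_index T T0 Tub Tjoin =>
                   (sval i).1 - (sval i).2).
Proof.
move=> archE; split => //.
- move=> i j [ji1 ij2]; apply: vl_leD => //.
  by rewrite vl_leN2.
- by move=> [[z t] /= [Uz Tt]]; rewrite vl_leBr0; exact: Uz.
- move=> w _ wgap.
  have wUT z t : ubound T z -> T t -> w <= z - t.
    by move=> Uz Tt; exact: (wgap (exist _ (z, t) (conj Uz Tt))).
  have Uw n z : ubound T z -> ubound T (z - w *+ n).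
    elim: n => [|n IH] Uz; first by rewrite mulr0n subr0.
    move=> t Tt; have := wUT _ _ (IH Uz) Tt.
    by rewrite vl_leBrDr addrC -vl_leBrDr mulrSr opprD addrA.
  have [t Tt] := T0; have [z Uz] := Tub.
  apply: (archE w (z - t)) => n.
  by have := Uw n.+1 z Uz t Tt; rewrite !vl_leBrDr addrC.
Qed.

End VectorLatticeComplements.

Lemma odual_archimedean (R : realType) (X : vectorLatticeType R) :
  archimedean (odual X).
Proof.
move=> f g fg; apply/odual_leP => x x0; rewrite leNgt; apply/negP => fx0.
have fxn n : f x *+ n.+1 <= g x.
  have /odual_leP/(_ x x0) := fg n; congr (_ <= _).
  by rewrite -!scaler_nat /= mulr_natl.
have gx0 : 0 <= g x / f x.
  rewrite divr_ge0 ?(ltW fx0) //; apply: le_trans (fxn 0%N).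
  by rewrite mulr1n ltW.
have := fxn (Num.truncn (g x / f x)).
rewrite -mulr_natl -ler_pdivlMr // leNgt.
by rewrite truncnS_gt.
Qed.

(** * Transfer of order and of order convergence between X and X~~ *)

Section RegularDualSystem.
Context {R : realType} {X : vectorLatticeType R}.
Hypothesis regX : regular_riesz_dual_system X.
Implicit Types (x y z : X).

Lemma hat_vabs x : hat (vabs x) = vabs (hat x).
Proof. by rewrite /vabs hat_vjoin hatN. Qed.

Lemma hat_inj : injective (@hat R X).
Proof.
move=> x y xy; apply: contrapT => /(proj1 regX)[f]; apply.
by have /(congr1 (fun F : odual (odual X) => F f)) := xy.
Qed.

(** The order is encoded by the equation [vjoin x y = y], which an injective lattice homomorphism
    reflects. *)
Lemma hat_leE x y : (hat x <= hat y) = (x <= y).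
Proof.
apply/idP/idP => [xy|]; last exact: hat_le.
have <- : vjoin x y = y.
  apply: hat_inj; rewrite hat_vjoin; apply/le_anti/andP; split.
    by rewrite vjoinP xy /=.
  exact: vjoinr.
exact: vjoinl.
Qed.

(** Since [hat] is an order embedding, the infimum is 0 in its range; regularity carries this over
    to X~~. *)
Lemma hat_decreases_to0 (J : directedSet) (y : J -> X) :
  decreases_to0 y -> decreases_to0 (fun j => hat (y j)).
Proof.
move=> [_ ydec y0 yinf]; apply: (proj2 (proj2 regX)); split.
- by move=> j; exists (y j).
- by move=> i j ij; rewrite hat_leE; exact: ydec.
- by move=> j; rewrite -hat0 hat_leE.
- move=> _ [w _ <-] wy; rewrite -hat0 hat_leE.
  by apply: yinf => // j; rewrite -hat_leE.
Qed.

Lemma hat_order_cvg0 (I : directedSet) (x : I -> X) :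
  order_cvg x 0 -> order_cvg (fun i => hat (x i)) 0.
Proof.
move=> [J [y [ydec xy]]]; exists J, (fun j => hat (y j)).
split; first exact: hat_decreases_to0.
move=> j; have [i0 xi0] := xy j; exists i0 => i /xi0.
by rewrite !subr0 -hat_vabs hat_leE.
Qed.

Lemma hat_order_cvg0_uo (I : directedSet) (x : I -> X) :
  archimedean X -> order_cvg (fun i => hat (x i)) 0 -> uo_cvg x 0.
Proof.
move=> archX [J [y [[_ ydec y0 yinf] xy]]] u u0.
pose T j : set X := [set t | hat t <= y j /\ t <= u].
pose D : set X := [set z | exists j, ubound (T j) z].
have Tu j : ubound (T j) u by move=> t [].
have D0 : D !=set0 by have [j] := ds_inhabited J; exists u, j.
have Dmeet z z' : D z -> D z' -> D (vmeet z z').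
  move=> [j Uz] [j' Uz']; have [k [jk j'k]] := ds_upper j j'.
  exists k => t [ty tu]; rewrite vmeetP Uz ?Uz' //.
    by split=> //; exact: le_trans ty (ydec _ _ j'k).
  by split=> //; exact: le_trans ty (ydec _ _ jk).
have T0 j : T j 0 by split; rewrite ?hat0.
exists (upper_set_index D D0 Dmeet), sval; split; last first.
  move=> [z [j Uz]] /=; have [i0 xi0] := xy j; exists i0 => i /xi0.
  rewrite !subr0 (ge0_vabs (vmeet _ _)) ?vmeet_ge0 ?vabs_ge0 // => xiy.
  (* On this tail |x_i| /\ u itself belongs to T_j, so it lies below z. *)
  apply: Uz; split; last exact: vmeetr.
  by apply: le_trans xiy; rewrite -hat_vabs hat_leE vmeetl.
split => //; first by move=> [z [j Uz]] /=; exact: Uz.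
move=> w _ wD; rewrite -hat_leE hat0; apply: yinf => // j.
have T0' : T j !=set0 by exists 0.
have Tub : ubound (T j) !=set0 by exists u.
have Tjoin s t : T j s -> T j t -> T j (vjoin s t).
  by move=> [sy su] [ty tu]; split; rewrite ?hat_vjoin vjoinP ?sy ?su.
have [_ _ _ ginf] :=
  hat_decreases_to0 _ _ (gap_decreases_to0 (T j) T0' Tub Tjoin archX).
(* For a gap z - t of T_j, w <= z and t^ <= y_j give w^ - y_j <= z^ - t^; these gaps have infimum 0
   in X~~. *)
rewrite -vl_leBr0 -vl_leN2 oppr0 opprB; apply: ginf => //.
move=> [[z t] /= [Uz [ty _]]]; rewrite hatD hatN; apply: vl_leD.
  by rewrite hat_leE; exact: (wD (exist _ z (ex_intro _ j Uz))).
by rewrite vl_leN2.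
Qed.

(** The two coordinates increase independently, as in the definition of a Cauchy net. *)
Definition square_index (T : set X) (T0 : T !=set0)
  (Tjoin : forall x y, T x -> T y -> T (vjoin x y)) : directedSet.
Proof.
refine (@DirectedSet {st : X * X | T st.1 /\ T st.2}
  (fun i j => (sval i).1 <= (sval j).1 /\ (sval i).2 <= (sval j).2) _ _ _ _).
- by move=> i.
- move=> i j k [ij1 ij2] [jk1 jk2].
  by split; [exact: le_trans ij1 jk1 | exact: le_trans ij2 jk2].
- move=> [[s t] /= [Ts Tt]] [[s' t'] /= [Ts' Tt']].
  exists (exist _ (vjoin s s', vjoin t t')
    (conj (Tjoin _ _ Ts Ts') (Tjoin _ _ Tt Tt'))) => /=.
  by rewrite !vjoinl !vjoinr.
- by case: T0 => t Tt; constructor; exists (t, t).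
Defined.

Lemma hat_bounded_above (b : odual (odual X)) :
  (forall (I : directedSet) (x : I -> X),
     order_cvg (fun i => hat (x i)) 0 -> order_cvg x 0) ->
  exists c, forall x, hat x <= b -> x <= c.
Proof.
move=> hat_cvg; pose T : set X := [set t | hat t <= b].
have [T0|Te] := pselect (T !=set0); last first.
  by exists 0 => x xb; case: Te; exists x.
have Tjoin s t : T s -> T t -> T (vjoin s t).
  by move=> sb tb; rewrite /T /= hat_vjoin vjoinP sb.
pose I := square_index T T0 Tjoin.
pose x (i : I) := (sval i).1 - (sval i).2.
have /hat_cvg[J [y [_ xy]]] : order_cvg (fun i => hat (x i)) 0.
  pose S : set (odual (odual X)) := [set hat t | t in T].
  have S0 : S !=set0 by have [t Tt] := T0; exists (hat t), t.
  have Sub : ubound S !=set0 by exists b => _ [t Tt <-].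
  have Sjoin f g : S f -> S g -> S (vjoin f g).
    move=> [s Ts <-] [t Tt <-]; exists (vjoin s t); rewrite ?hat_vjoin //.
    exact: (Tjoin _ _ Ts Tt).
  exists (gap_index S S0 Sub Sjoin), (fun i => (sval i).1 - (sval i).2).
  split; first exact: gap_decreases_to0 (@odual_archimedean R (odual X)).
  move=> [[z _] /= [Uz [t Tt <-]]].
  (* Beyond (t, t), both s^ and s'^ lie between t^ and z, so they differ by at most z - t^. *)
  exists (exist _ (t, t) (conj Tt Tt)) => -[[s s'] /= [Ts Ts']] [/= ts ts'].
  rewrite subr0 /x /= hatD hatN vabsP opprB.
  by rewrite !vl_leD ?vl_leN2 ?hat_leE //; apply: Uz; [exists s'|exists s].
have [j] := ds_inhabited J; have [[[s0 t0] /= [Ts0 Tt0]] xi0] := xy j.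
exists (y j + t0) => s Ts.
(* Joining s with s0 moves the index beyond (s0, t0) while t0 stays fixed. *)
have := xi0 (exist _ (vjoin s s0, t0) (conj (Tjoin _ _ Ts Ts0) Tt0)).
rewrite subr0 /x /= => /(_ (conj (vjoinr s s0) (lexx t0))).
rewrite vabsP => /andP[+ _]; rewrite vl_leBlDr; apply: le_trans.
exact: vjoinl.
Qed.

End RegularDualSystem.

Theorem theorem2 (R : realType) (X : vectorLatticeType R)
    (archX : archimedean X) (regX : regular_riesz_dual_system X) :
  [<->
    (* (i) *)
    b_property X;
    (* (ii) *)
    forall (I : directedSet) (x : I -> X), bbuo_cvg x 0 -> order_cvg x 0;
    (* (iii) *)
    forall (I : directedSet) (x : I -> X),
      order_cvg (fun i => hat (x i)) 0 -> order_cvg x 0;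
    (* (iv) *)
    forall (I : directedSet) (x : I -> X),
      order_cvg (fun i => hat (x i)) 0 <-> order_cvg x 0].
Proof.
tfae.
- move=> bX I x [xuo [i0 [a [b xab]]]].
  have [|c [d xcd]] := bX [set x i | i in [set i | ds_le i0 i]].
    by exists a, b => _ [_ [i ii0 <-] <-]; apply: xab; exists i.
  (* This u dominates |x_i| on a tail, where the truncation by u therefore has no effect. *)
  pose u := vjoin (vabs c) (vabs d).
  have u0 : 0 <= u by apply: le_trans (vabs_ge0 c) (vjoinl _ _).
  have [J [y [ydec xy]]] := xuo u u0; exists J, y; split=> // j.
  have [i1 xi1] := xy j; have [k [ik i1k]] := ds_upper i0 i1.
  exists k => i ki; have := xi1 i (ds_trans i1k ki).
  rewrite !subr0 ge0_vabs ?vmeet_ge0 ?vabs_ge0 // vmeet_idl //.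
  have /andP[cx xd] : c <= x i <= d.
    by apply: xcd; exists i => //; exact: ds_trans ik ki.
  rewrite vabsP; apply/andP; split.
    by apply: le_trans xd _; apply: le_trans (vabs_ge d) (vjoinr _ _).
  apply: (@le_trans _ _ (- c)); first by rewrite vl_leN2.
  by apply: le_trans (vabs_geN c) (vjoinl _ _).
- move=> bbuo I x xo; apply: bbuo; split.
    exact: hat_order_cvg0_uo.
  exact: order_cvg_eventually_bounded.
- by move=> hat_cvg I x; split; [exact: hat_cvg | exact: hat_order_cvg0].
- move=> hat_cvg A [a [b Aab]].
  have bound e := hat_bounded_above regX e (fun I x => proj1 (hat_cvg I x)).
  (* The lower bound of A comes from an upper bound of -A, whose image lies below -a. *)
  have [d bd] := bound b; have [c ac] := bound (- a).
  exists (- c), d => x Ax; have /andP[ax xb] := Aab _ (imageP _ Ax).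
  by rewrite bd // andbT -vl_leN2 opprK ac // hatN vl_leN2.
Qed.
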